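(* If $T$ is a tree of order $n \ge 2$, then $\gamma_{1\mathrm{fd}}(T) \le n/2$, with equality if and only if $T$ is the corona of a tree.
   Context: All graphs are finite and simple; $N(v)$ denotes the open neighborhood of $v$. A 1-fair dominating set (1FD-set) of a graph $G=(V,E)$ is a dominating set $D \subseteq V$ such that $|N(v) \cap D| = 1$ for every $v \in V \setminus D$ (the set $D=V$ qualifies vacuously). $\gamma_{1\mathrm{fd}}(G)$ denotes the minimum cardinality of a 1FD-set of $G$. The corona of a graph $H$ is the graph of order $2|V(H)|$ obtained from $H$ by attaching a new leaf (pendant vertex) to each vertex of $H$. *)

(* Defs.v *)
From HB Require Import structures.
From mathcomp Require Import all_boot all_order all_algebra.

Set Implicit Arguments.
Unset Strict Implicit.
Unset Printing Implicit Defensive.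

Record sgraph := SGraph {
  vertex :> finType;
  edge : rel vertex;
  edge_sym : symmetric edge;
  edge_irr : irreflexive edge
}.

Definition nbhd (G : sgraph) (v : G) : {set G} := [set u | edge v u].

Definition connected (G : sgraph) : Prop :=
  forall x y : G, connect (@edge G) x y.

(* Without the size bound, [:: x; y] with x adjacent to y would be a ucycle. *)
Definition acyclic (G : sgraph) : Prop :=
  forall c : seq G, 2 < size c -> ~ ucycle (@edge G) c.

Definition is_tree (G : sgraph) : Prop :=
  [/\ 0 < #|G|, connected G & acyclic G].

Definition dominating (G : sgraph) (D : {set G}) : bool :=
  [forall v, (v \notin D) ==> [exists u in D, edge v u]].

Definition fd1_set (G : sgraph) (D : {set G}) : bool :=
  dominating D && [forall v, (v \notin D) ==> (#|nbhd v :&: D| == 1)].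

Definition gamma_1fd (G : sgraph) : nat :=
  #|[arg min_(D < [set: G] | fd1_set D) #|D|]|.

(* arg min falls back on its base point when that point does not satisfy the
   predicate; fd1_setT rules this out. *)
Lemma fd1_setT (G : sgraph) : fd1_set [set: G].
Proof. by apply/andP; split; apply/forallP=> v; rewrite inE. Qed.

Lemma gamma_1fd_attained (G : sgraph) :
  exists2 D : {set G}, fd1_set D & #|D| = gamma_1fd G.
Proof.
by rewrite /gamma_1fd; case: arg_minnP => [|D HD _]; [exact: fd1_setT | exists D].
Qed.

Lemma gamma_1fd_min (G : sgraph) (D : {set G}) :
  fd1_set D -> gamma_1fd G <= #|D|.
Proof.
by rewrite /gamma_1fd; case: arg_minnP => [|D0 _ min_D0 /min_D0]; first exact: fd1_setT.
Qed.

Definition isomorphic (G H : sgraph) : Prop :=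
  exists2 f : G -> H, bijective f & forall x y, edge (f x) (f y) = edge x y.

(* inl x is the vertex x of H, and inr x the leaf attached to x. *)
Definition corona_edge (H : sgraph) : rel (H + H)%type :=
  fun a b => match a, b with
  | inl x, inl y => edge x y
  | inl x, inr y => x == y
  | inr x, inl y => x == y
  | inr _, inr _ => false
  end.

Lemma corona_edge_sym (H : sgraph) : symmetric (@corona_edge H).
Proof. by case=> x [] y /=; rewrite ?(eq_sym x) //; exact: edge_sym. Qed.

Lemma corona_edge_irr (H : sgraph) : irreflexive (@corona_edge H).
Proof. by case=> x //=; exact: edge_irr. Qed.

Definition corona (H : sgraph) : sgraph :=
  SGraph (@corona_edge_sym H) (@corona_edge_irr H).

(* Main.v *)
Require Import Defs.
From HB Require Import structures.
From mathcomp Require Import all_boot all_order all_algebra.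
From mathcomp Require Import zify.

(** Root the tree and build it up by repeatedly joining a branch rooted at [w]
    to a part rooted at [v] along the edge [vw].  For a part [A] with root [v],
    consider the smallest sets that are 1-fair dominating in [A] and either
    contain [v], or omit [v] and dominate it, or omit [v] with no neighbor of
    [v] chosen (leaving [v] to its parent).  Comparing these three sizes with
    [#|A| / 2] gives finitely many kinds of parts, and joining never leaves this
    list.  At the full tree every kind yields a set of size at most [n / 2].
    Equality survives only for coronas, or when the root is a leaf; in the latter
    case we move the root to its neighbor. *)

Set Implicit Arguments.
Unset Strict Implicit.
Unset Printing Implicit Defensive.

(** * Decomposing a tree into rooted parts *)

Definition induced_edge (G : sgraph) (A : {set G}) : rel G :=
  fun x y => [&& x \in A, y \in A & edge x y].

Definition glue (G : sgraph) (A B : {set G}) (v w : G) : Prop :=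
  [/\ v \in A, w \in B, [disjoint A & B], edge v w &
      forall x y, x \in A -> y \in B -> edge x y -> x = v /\ y = w].

Inductive rtree (G : sgraph) : {set G} -> G -> Prop :=
  | rtree1 v : rtree [set v] v
  | rtree_glue A B v w :
      rtree A v -> rtree B w -> glue A B v w -> rtree (A :|: B) v.

Lemma path_induced_sub (G : sgraph) (A : {set G}) (w : G) (p : seq G) :
  path (induced_edge A) w p -> {subset p <= A}.
Proof.
elim: p w => //= a p IHp w /andP[/and3P[_ aA _] pA] u.
by rewrite inE => /predU1P[->|]; [|exact: (IHp a)].
Qed.

Lemma connect_rooted_ind (T : finType) (e : rel T) (v : T) (P : T -> Prop) :
  P v -> (forall x y, connect e v x -> P x -> e x y -> P y) ->
  forall x, connect e v x -> P x.
Proof.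
move=> Pv Pe x /connectP [p]; elim/last_ind: p x => [|p y IHp] x /=; first by move=> _ ->.
rewrite rcons_path last_rcons => /andP [ep ey] ->.
apply: Pe ey; last exact: IHp.
by apply/connectP; exists p.
Qed.

(** Split off the component [B] of a neighbor [w] of [v] in [A :\ v]. Both [B] and [A :\: B] are
    smaller and connected, and acyclicity leaves [vw] as the only edge between them. *)
Lemma rtree_induced (G : sgraph) (A : {set G}) (v : G) :
  acyclic G -> v \in A -> (forall x, x \in A -> connect (induced_edge A) v x) ->
  rtree A v.
Proof.
move=> acG; move: {2}#|A| (leqnn #|A|) => n.
elim: n A v => [|n IHn] A v leA vA conA.
  by move: leA; rewrite leqn0 cards_eq0 => /eqP A0; rewrite A0 inE in vA.
have [sA|[x xA xv]] : A \subset [set v] \/ exists2 x, x \in A & x != v.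
- case: (boolP (A \subset [set v])) => [|/subsetPn[x xA xv]]; first by left.
  by right; exists x => //; rewrite inE in xv.
- have -> : A = [set v] by apply/eqP; rewrite eqEsubset sA sub1set.
  exact: rtree1.
have [w evw wv] : exists2 w, induced_edge A v w & w != v.
  case/connectP: (conA x xA) => [[|w p]] /=; first by move=> _ Ex; rewrite Ex eqxx in xv.
  case/andP => evw _ _; exists w => //.
  by case/and3P: evw => _ _ evw; apply/eqP => E; rewrite E edge_irr in evw.
have /and3P [_ wA edvw] := evw.
set e := induced_edge (A :\ v).
pose B := [set y | connect e w y].
have wB : w \in B by rewrite inE connect0.
have sBA : {subset B <= A :\ v}.
  move=> y; rewrite inE => /connectP[p /path_induced_sub pA ->].
  have := mem_last w p; rewrite inE => /predU1P[->|/pA//].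
  by rewrite !inE wv.
have vB : v \notin B by apply/negP => /sBA; rewrite !inE eqxx.
have stepB y z : y \in B -> z \in A -> z != v -> edge y z -> z \in B.
  move=> yB zA zv yz; have yAv := sBA _ yB.
  rewrite inE; apply: (connect_trans (y := y)); first by rewrite inE in yB.
  by apply: connect1; rewrite /e /induced_edge yAv !inE zv zA.
have EA : A = (A :\: B) :|: B.
  apply/setP=> y; rewrite in_setU in_setD.
  by case: (boolP (y \in B)) => //= [/sBA|_]; rewrite ?inE ?orbF // => /andP[_ ->].
have vAB : v \in A :\: B by rewrite in_setD vB.
rewrite EA; apply: (@rtree_glue _ _ _ v w).
- apply: IHn => //.
    rewrite -ltnS; apply: leq_trans leA; apply: proper_card.
    apply/properP; split; first exact: subsetDl.
    by exists w => //; rewrite in_setD wB.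
  (* Follow a walk from [v]: a vertex outside [B] other than [v] is never entered from [B], and a
     return to [v] starts afresh. *)
  move=> y; rewrite in_setD => /andP[yB /conA Hy]; move: yB.
  apply/implyP; move: y Hy.
  apply: connect_rooted_ind => [|y z _ /implyP Py /and3P[yA zA yz]].
    by rewrite connect0 implybT.
  apply/implyP=> zB; have [->|zv] := eqVneq z v; first exact: connect0.
  have yB : y \notin B by apply: contra zB => yB; exact: (stepB y).
  apply: connect_trans (Py yB) (connect1 _).
  by rewrite /induced_edge !in_setD yA yB zA zB.
- apply: IHn => //.
    rewrite -ltnS; apply: leq_trans leA; apply: proper_card.
    apply/properP; split; last by exists v.
    by apply/subsetP=> y /sBA; rewrite inE => /andP[].
  move=> y; rewrite inE.
  move: y; apply: connect_rooted_ind => [|y z wy Py yz]; first exact: connect0.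
  apply: connect_trans Py (connect1 _).
  case/and3P: (yz) => _ _ eyz.
  by rewrite /induced_edge !inE wy (connect_trans wy (connect1 yz)).
split=> //.
  by rewrite -setI_eq0 setIDAC -setIDA setDv setI0.
move=> y z; rewrite in_setD => /andP[yB yA] zB yz.
have yv : y = v.
  apply/eqP; apply: contraNT yB => yv.
  by apply: (stepB z) => //; rewrite edge_sym.
split=> //; subst y.
(* A second neighbor [z] of [v] in [B] would turn a simple path from [w] to [z] avoiding [v] into a
   cycle through [v]. *)
apply/eqP; apply: contraT => zw.
have: connect e w z by rewrite inE in zB.
case/connectP => p0 p0P Ez; move: p0P Ez zw.
case/shortenP=> p ep up _ Ez zw.
have pA : {subset w :: p <= A :\ v}.
  move=> u; rewrite inE => /predU1P[->|]; first exact: sBA.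
  exact: path_induced_sub ep u.
case: (acG (v :: w :: p)).
  by case: p Ez {ep up pA} => //= Ez; rewrite Ez eqxx in zw.
apply/andP; split; last first.
  rewrite cons_uniq up andbT; apply/negP => /pA; by rewrite !inE eqxx.
rewrite /= edvw rcons_path -Ez edge_sym yz andbT.
by apply: sub_path ep => a b /and3P[].
Qed.

Lemma rtree_setT (T : sgraph) (v : T) : is_tree T -> rtree [set: T] v.
Proof.
case=> _ conT acT; apply: rtree_induced => // x _.
apply: etrans (conT v x); apply: eq_connect => a b.
by rewrite /induced_edge !inE.
Qed.

(** * Counting across a glued edge *)

(** Since [vw] is the only edge between [A] and [B], the set [Y] can contribute only [w], and only
    to [v]. *)
Lemma card_nbhd_glue (G : sgraph) (A B X Y : {set G}) (v w x : G) :
  glue A B v w -> X \subset A -> Y \subset B -> x \in A ->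
  #|nbhd x :&: (X :|: Y)| = #|nbhd x :&: X| + ((x == v) && (w \in Y)).
Proof.
case=> vA wB dAB vw cross /subsetP XA /subsetP YB xA.
have disXY z : z \in X -> z \in Y -> False.
  by move=> /XA zA /YB; rewrite (disjointFr dAB zA).
rewrite setIUr cardsU [_ :&: _ :&: _](_ : _ = set0) ?cards0 ?subn0.
  congr (_ + _); case: (boolP (_ && _)) => [/andP[/eqP -> wY]|nY] /=.
    apply/eqP/cards1P; exists w; apply/setP=> z; rewrite !inE.
    apply/andP/eqP => [[vz zY]|->//].
    by case: (cross v z vA (YB _ zY) vz).
  apply/eqP; rewrite cards_eq0; apply/eqP/setP=> z; rewrite !inE.
  apply: contraNF nY => /andP[xz zY].
  by case: (cross x z xA (YB _ zY) xz) => -> <-; rewrite eqxx.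
apply/setP=> z; rewrite !inE; apply/negP=> /andP[/andP[_ zX] /andP[_ zY]].
exact: disXY zX zY.
Qed.

Lemma glue_sym (G : sgraph) (A B : {set G}) (v w : G) :
  glue A B v w -> glue B A w v.
Proof.
case=> vA wB dAB vw cross; split=> //; first by rewrite disjoint_sym.
  by rewrite edge_sym.
by move=> x y xB yA xy; case: (cross y x yA xB) => //; rewrite edge_sym.
Qed.

Lemma card_glue (G : sgraph) (A B X Y : {set G}) (v w : G) :
  glue A B v w -> X \subset A -> Y \subset B -> #|X :|: Y| = #|X| + #|Y|.
Proof.
case=> _ _ dAB _ _ XA YB; apply/eqP.
by rewrite leq_card_setU; apply: disjointWl XA _; apply: disjointWr YB _.
Qed.

(** * Partial 1-fair dominating sets *)

(* A 1-fair dominating set of the part [A], where the root [v] is exempt: [b]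
   tells whether [v] is chosen, and if not then [v] has [k] chosen neighbors.
   The slack [s] means [#|D| <= (#|A| + 1 - s) / 2], so that [s = 0] is what
   choosing the vertex of a one-vertex part gives. *)
Definition partial_fd1 (G : sgraph) (A : {set G}) (v : G) (b : bool) (k s : nat) :=
  exists D : {set G},
    [/\ D \subset A, (v \in D) = b, ~~ b -> #|nbhd v :&: D| = k,
        forall x, x \in A -> x != v -> x \notin D -> #|nbhd x :&: D| = 1
      & 2 * #|D| + s <= #|A|.+1].

(** Take the union of the two sets. The vertex [w] stops being exempt, so it must be chosen or have
    exactly one chosen neighbor, counting [v]. Two terms [+1] merge into one in the size bounds, so
    the slacks add up with a loss of 1. *)
Lemma partial_fd1_glue (G : sgraph) (A B : {set G}) (v w : G)
    (b b' : bool) (k k' s s' t : nat) :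
  partial_fd1 A v b k s -> partial_fd1 B w b' k' s' -> glue A B v w ->
  b' || (k' + b == 1) -> t < s + s' ->
  partial_fd1 (A :|: B) v b (k + b') t.
Proof.
move=> [D [DA vD kD fD sD]] [D' [DB wD kD' fD' sD']] gl bk lt.
have gl' := glue_sym gl; have [vA wB dAB vw _] := gl.
have vB : v \notin B by rewrite (disjointFr dAB).
have nD' x : x \in A -> (x \in D :|: D') = (x \in D).
  move=> xA; rewrite inE [x \in D'](contraFF (subsetP DB x)) ?orbF //.
  exact: disjointFr dAB xA.
have nD x : x \in B -> (x \in D :|: D') = (x \in D').
  move=> xB; rewrite inE [x \in D](contraFF (subsetP DA x)) //.
  exact: disjointFl dAB xB.
exists (D :|: D'); split.
- exact: setUSS.
- by rewrite nD'.
- by move=> nb; rewrite (card_nbhd_glue gl) // eqxx wD kD.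
- move=> x; rewrite in_setU => /orP[xA|xB] xv.
    rewrite nD' // (card_nbhd_glue gl) // (negPf xv) addn0; exact: fD.
  rewrite nD // setUC (card_nbhd_glue gl') // vD.
  have [->|xw] := eqVneq x w; last by rewrite addn0; exact: fD'.
  by rewrite wD /= => nb'; rewrite kD' //; move: bk; rewrite (negPf nb') => /eqP.
- rewrite (card_glue gl DA DB) (card_glue gl (subxx _) (subxx _)).
  by move: #|D| #|D'| #|A| #|B| sD sD' lt => d d' a a'; clear; lia.
Qed.

Lemma partial_fd1_weaken (G : sgraph) (A : {set G}) (v : G) b k s s' :
  s' <= s -> partial_fd1 A v b k s -> partial_fd1 A v b k s'.
Proof. by move=> les [D [? ? ? ? ?]]; exists D; split=> //; lia. Qed.

Lemma partial_fd1_true (G : sgraph) (A : {set G}) (v : G) k k' s :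
  partial_fd1 A v true k s -> partial_fd1 A v true k' s.
Proof. by move=> [D [? ? ? ? ?]]; exists D; split. Qed.

(** * Partial coronas *)

(* With l = true, [A] is a corona whose centers [C] include the root [v]; with
   l = false, only the leaf at [v] is missing. *)
Definition partial_corona (G : sgraph) (A : {set G}) (v : G) (l : bool) :=
  exists C M : {set G},
    [/\ A = C :|: M, [disjoint C & M], v \in C,
        forall x, x \in M -> #|nbhd x :&: C| = 1 /\ #|nbhd x :&: M| = 0
      & forall x, x \in C -> #|nbhd x :&: M| = (x != v) || l].

(** The edge [vw] joins two centers, so no leaf gains a neighbor and no center gains a leaf. *)
Lemma partial_corona_glue (G : sgraph) (A B : {set G}) (v w : G) (l : bool) :
  partial_corona A v l -> partial_corona B w true -> glue A B v w ->
  partial_corona (A :|: B) v l.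
Proof.
move=> [C [M [EA dCM vC fM fC]]] [C' [M' [EB dCM' wC' fM' fC']]] gl.
have gl' := glue_sym gl; have [vA wB dAB _ _] := gl.
have [CA MA] : C \subset A /\ M \subset A by rewrite EA subsetUl subsetUr.
have [CB MB] : C' \subset B /\ M' \subset B by rewrite EB subsetUl subsetUr.
have vM : (v \in M) = false by rewrite (disjointFr dCM).
have wM : (w \in M') = false by rewrite (disjointFr dCM').
have nMv x : x \in M -> (x == v) = false by apply: contraTF => /eqP ->; rewrite vM.
have nMw x : x \in M' -> (x == w) = false by apply: contraTF => /eqP ->; rewrite wM.
exists (C :|: C'), (M :|: M'); split.
- by rewrite EA EB setUACA.
- rewrite -setI_eq0 setIUl !setIUr (disjoint_setI0 dCM) (disjoint_setI0 dCM').
  rewrite set0U setU0 (disjoint_setI0 (disjointWl CA (disjointWr MB dAB))) set0U.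
  by rewrite setIC (disjoint_setI0 (disjointWl MA (disjointWr CB dAB))).
- by rewrite inE vC.
- move=> x; rewrite in_setU => /orP[xM|xM].
    have xA := subsetP MA x xM.
    by rewrite !(card_nbhd_glue gl) // nMv //= !addn0; exact: fM.
  have xB := subsetP MB x xM.
  rewrite [C :|: _]setUC [M :|: _]setUC !(card_nbhd_glue gl') // nMw //= !addn0.
  exact: fM'.
- move=> x; rewrite in_setU => /orP[xC|xC].
    have xA := subsetP CA x xC.
    by rewrite (card_nbhd_glue gl) // wM andbF addn0; exact: fC.
  have xB := subsetP CB x xC.
  rewrite setUC (card_nbhd_glue gl') // vM andbF addn0 fC' // orbT.
  suff -> : x != v by [].
  by apply: contraTneq xB => ->; rewrite (disjointFr dAB).
Qed.

Lemma partial_corona_add_leaf (G : sgraph) (A : {set G}) (v w : G) :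
  partial_corona A v false -> glue A [set w] v w ->
  partial_corona (A :|: [set w]) v true.
Proof.
move=> [C [M [EA dCM vC fM fC]]] gl.
have gl' := glue_sym gl; have [vA _ dAB _ _] := gl.
have [CA MA] : C \subset A /\ M \subset A by rewrite EA subsetUl subsetUr.
have vM : (v \in M) = false by rewrite (disjointFr dCM).
have nMv x : x \in M -> (x == v) = false by apply: contraTF => /eqP ->; rewrite vM.
have n0 x : #|nbhd x :&: set0| = 0 by rewrite setI0 cards0.
have ww : w \in [set w] by rewrite inE.
exists C, (M :|: [set w]); split=> //.
- by rewrite EA setUA.
- rewrite -setI_eq0 setIUr (disjoint_setI0 dCM) set0U.
  by rewrite (disjoint_setI0 (disjointWl CA dAB)).
- move=> x; rewrite in_setU => /orP[xM|].
    rewrite (card_nbhd_glue gl) ?(subsetP MA) // nMv // addn0; exact: fM.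
  rewrite inE => /eqP ->; split.
    rewrite -[C]set0U (card_nbhd_glue gl') ?sub0set // n0 eqxx vC //.
  rewrite setUC (card_nbhd_glue gl') // eqxx vM addn0.
  by apply/eqP; rewrite cards_eq0; apply/eqP/setP=> z; rewrite !inE;
    apply/negP=> /andP[wz /eqP E]; rewrite E edge_irr in wz.
- move=> x xC; rewrite (card_nbhd_glue gl) ?(subsetP CA) // fC // inE eqxx.
  by case: eqVneq.
Qed.

(** * One-vertex parts *)

Lemma partial_corona1 (G : sgraph) (v : G) : partial_corona [set v] v false.
Proof.
exists [set v], set0; split; rewrite ?setU0 ?inE //.
- by rewrite -setI_eq0 setI0.
- by move=> x; rewrite inE.
- by move=> x; rewrite inE => /eqP ->; rewrite setI0 cards0 eqxx.
Qed.

Lemma partial_fd1_in1 (G : sgraph) (v : G) k : partial_fd1 [set v] v true k 0.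
Proof.
exists [set v]; split; rewrite ?inE ?eqxx ?cards1 //.
by move=> x; rewrite inE => ->.
Qed.

Lemma partial_fd1_out1 (G : sgraph) (v : G) : partial_fd1 [set v] v false 0 2.
Proof.
exists set0; split; rewrite ?sub0set ?inE ?setI0 ?cards0 ?cards1 //.
by move=> x; rewrite inE => ->.
Qed.

(** * The kinds of rooted parts and their closure under joining *)

(* For [2 <= #|A|], all but [Corona] and [Pendant] give a 1-fair dominating set
   of size less than [#|A| / 2]; in [Pendant] the root has degree 1. *)
Inductive rooted_shape (G : sgraph) (A : {set G}) (v : G) : Prop :=
  | Single of A = [set v]
  | BareCorona of partial_corona A v false & partial_fd1 A v true 0 0
      & partial_fd1 A v false 1 2 & partial_fd1 A v false 0 2
  | Bare of partial_fd1 A v true 0 0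
      & partial_fd1 A v false 1 2 & partial_fd1 A v false 0 3
  | Corona of partial_corona A v true & partial_fd1 A v true 0 1
      & partial_fd1 A v false 1 1
  | SlackOut of partial_fd1 A v true 0 1 & partial_fd1 A v false 1 2
  | Pendant of partial_fd1 A v true 0 1 & partial_fd1 A v false 1 1
      & partial_fd1 A v false 0 3 & #|nbhd v :&: A| <= 1 & 2 < #|A|
  | SlackIn of partial_fd1 A v true 0 2.

Lemma partial_fd1_glue_in (G : sgraph) (A B : {set G}) (v w : G) b (s s' t : nat) :
  glue A B v w -> partial_fd1 A v true 0 s -> partial_fd1 B w b 0 s' ->
  t < s + s' -> partial_fd1 (A :|: B) v true 0 t.
Proof.
move=> gl pA pB lt; apply: partial_fd1_true.
by apply: (partial_fd1_glue pA pB gl); rewrite ?orbT.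
Qed.

Lemma partial1 (G : sgraph) (v : G) :
  [/\ partial_corona [set v] v false, partial_fd1 [set v] v true 0 0
    & partial_fd1 [set v] v false 0 2].
Proof.
by split; [exact: partial_corona1 | exact: partial_fd1_in1 | exact: partial_fd1_out1].
Qed.

Lemma partial_fd1_out_card (G : sgraph) (A : {set G}) (v : G) s :
  v \in A -> partial_fd1 A v false 1 s -> 1 < #|A|.
Proof.
move=> vA [D [DA vD /(_ isT)/eqP/cards1P[x Ex] _ _]].
have: x \in nbhd v :&: D by rewrite Ex set11.
rewrite inE => /andP[_ xD].
apply/card_gt1P; exists v, x; split=> //; first exact: (subsetP DA).
by apply: contraFneq vD => ->.
Qed.

(** Here [w] is the only neighbor of [v], which gives the shape [Pendant]. Its slacks 1, 1 and 3 are
    0+2, 2+0 and 2+2, each less 1. *)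
Lemma rooted_shape_glue_Bare (G : sgraph) (v w : G) (B : {set G}) :
  glue [set v] B v w -> partial_fd1 B w true 0 0 -> partial_fd1 B w false 1 2 ->
  partial_fd1 B w false 0 2 -> rooted_shape ([set v] :|: B) v.
Proof.
move=> gl pi po pn; have [_ in1 out1] := partial1 v; have [vA wB dAB _ _] := gl.
apply: Pendant.
- exact: (partial_fd1_glue_in gl in1 pn).
- exact: (partial_fd1_glue out1 pi gl).
- exact: (partial_fd1_glue out1 po gl).
- rewrite (card_nbhd_glue gl) ?subxx // (_ : _ :&: _ = set0).
    by rewrite cards0 add0n leq_b1.
  apply/setP=> z; rewrite !inE; apply/negP=> /andP[vz /eqP E].
  by rewrite E edge_irr in vz.
- rewrite (card_glue gl) ?subxx // cards1 add1n ltnS.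
  exact: partial_fd1_out_card po.
Qed.

Lemma rooted_shape_glue (G : sgraph) (A B : {set G}) (v w : G) :
  rooted_shape A v -> rooted_shape B w -> glue A B v w -> rooted_shape (A :|: B) v.
Proof.
move=> shA shB gl.
have inG := partial_fd1_glue_in gl.
have outG k b k' s s' t pA pB bk :=
  @partial_fd1_glue _ _ _ _ _ false b k k' s s' t pA pB gl bk.
case: shB => [EB|cB piB poB pnB|piB poB pnB|cB piB poB|piB poB|piB poB pnB _ _|piB];
case: shA => [EA|cA pi po pn|pi po pn|cA pi po|pi po|pi po pn _ _|pi];
  (* Only a [Single] part leaves the names [piB] or [pi] free, so the one-vertex sets are supplied
     exactly there. *)
  try have [_ piB pnB] := partial1 w; try have [cA pi pn] := partial1 v;
  try subst A; try subst B.
(* For each of the 49 pairs, the first shape that fits is taken. If [v] is chosen ([inG]), then [w]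
   is chosen too or has [v] as its only chosen neighbor. If [v] is omitted ([outG]), it is dominated
   inside [A] ([po]), dominated by [w] ([pn] with [piB]), or left to its parent ([pn] with
   [poB]). *)
all: first
  [ by apply: (rooted_shape_glue_Bare gl)
  | by apply: (rooted_shape_glue_Bare gl) => //; apply: partial_fd1_weaken pnB
  | by apply: Corona;
      [ exact: partial_corona_add_leaf | exact: (inG _ _ _ _ pi pnB)
      | exact: (outG _ _ _ _ _ _ pn piB)]
  | by apply: Corona;
      [ exact: (partial_corona_glue cA cB gl) | exact: (inG _ _ _ _ pi piB)
      | exact: (outG _ _ _ _ _ _ po poB)]
  | by apply: SlackIn; first [exact: (inG _ _ _ _ pi piB) | exact: (inG _ _ _ _ pi pnB)]
  | by apply: SlackOut;
      [ first [exact: (inG _ _ _ _ pi piB) | exact: (inG _ _ _ _ pi pnB)]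
      | first [exact: (outG _ _ _ _ _ _ po poB) | exact: (outG _ _ _ _ _ _ pn piB)]]
  | by apply: BareCorona;
      [ exact: (partial_corona_glue cA cB gl) | exact: (inG _ _ _ _ pi piB)
      | first [exact: (outG _ _ _ _ _ _ po poB) | exact: (outG _ _ _ _ _ _ pn piB)]
      | exact: (outG _ _ _ _ _ _ pn poB)]
  | by apply: Bare;
      [ exact: (inG _ _ _ _ pi piB)
      | first [exact: (outG _ _ _ _ _ _ po poB) | exact: (outG _ _ _ _ _ _ pn piB)]
      | exact: (outG _ _ _ _ _ _ pn poB)]].
Qed.

(** * The bound for trees and the case of equality *)

Lemma fd1_set_nbhd (G : sgraph) (D : {set G}) :
  (forall x, x \notin D -> #|nbhd x :&: D| = 1) -> fd1_set D.
Proof.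
move=> fD; apply/andP; split; apply/forallP=> x; apply/implyP=> /fD; last by move/eqP.
move/eqP/cards1P=> [y E]; have: y \in nbhd x :&: D by rewrite E set11.
by rewrite !inE => /andP[xy yD]; apply/existsP; exists y; rewrite yD.
Qed.

(** In the whole graph the root has no parent to dominate it, so it must be chosen or have exactly
    one chosen neighbor. *)
Lemma gamma_1fd_partial (G : sgraph) (v : G) (b : bool) (k s : nat) :
  partial_fd1 [set: G] v b k s -> b || (k == 1) -> 2 * gamma_1fd G + s <= #|G|.+1.
Proof.
move=> [D [_ vD kD fD sD]] bk; move: sD; rewrite cardsT; apply: leq_trans.
rewrite leq_add2r leq_mul2l /=; apply/gamma_1fd_min/fd1_set_nbhd => x xD.
have [E|xv] := eqVneq x v; last exact: fD.
subst x; rewrite vD in xD; rewrite (negPf xD) in bk.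
by rewrite kD //; exact/eqP.
Qed.

(** Slack 1 gives the bound and slack 2 makes it strict. Among parts with at least two vertices,
    only [Corona] and [Pendant] have no slack-2 set that also serves the root. *)
Lemma gamma_1fd_tree (T : sgraph) (v : T) :
  is_tree T -> 1 < #|T| -> 2 * gamma_1fd T <= #|T| /\
  (2 * gamma_1fd T = #|T| ->
   partial_corona [set: T] v true \/ #|nbhd v| <= 1 /\ 2 < #|T|).
Proof.
move=> tT cT.
have: rooted_shape [set: T] v.
  elim: (rtree_setT v tT) => [u|A B u w _ shA _ shB]; first exact: Single.
  exact: rooted_shape_glue.
case=> [E|_ _ po _|_ po _|cA pi _|_ po|pi _ _ dv cA|pi].
- by move: cT; rewrite -cardsT E cards1.
- have := gamma_1fd_partial po isT; lia.
- have := gamma_1fd_partial po isT; lia.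
- by have := gamma_1fd_partial pi isT; split; [lia | left].
- have := gamma_1fd_partial po isT; lia.
- have := gamma_1fd_partial pi isT; split; first lia.
  by right; rewrite -cardsT -[nbhd v]setIT.
- have := gamma_1fd_partial pi isT; lia.
Qed.

(** The pair of [v] and [w] is closed under adjacency, so by connectedness it is everything. *)
Lemma card_le2_pendant_edge (G : sgraph) (v w : G) :
  connected G -> edge v w -> #|nbhd v| <= 1 -> #|nbhd w| <= 1 -> #|G| <= 2.
Proof.
move=> conG vw dv dw.
have nb (x y z : G) : #|nbhd x| <= 1 -> edge x y -> edge x z -> z = y.
  by move=> dx xy xz; apply: (card_le1_eqP dx); rewrite inE.
have wv : edge w v by rewrite edge_sym.
suff /subset_leq_card : [set: G] \subset [set v; w].
  by rewrite cardsT cards2 => /leq_trans; apply; case: (v != w).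
apply/subsetP=> x _; move: x (conG v x).
apply: connect_rooted_ind => [|x y _]; rewrite !inE ?eqxx //.
case/orP=> /eqP-> e.
  by have /eqP-> := nb _ _ _ dv vw e; rewrite orbT.
by have /eqP-> := nb _ _ _ dw wv e.
Qed.

(** If rooting at [v] does not exhibit a corona, then [v] is a leaf; root at its neighbor [w]
    instead. With more than two vertices, [v] and [w] cannot both be leaves. *)
Lemma partial_corona_tree (T : sgraph) :
  is_tree T -> 1 < #|T| -> 2 * gamma_1fd T = #|T| ->
  exists v : T, partial_corona [set: T] v true.
Proof.
move=> tT cT gT; have [/card_gt0P[v _] conT _] := tT.
have [_ /(_ gT)[|[dv c3]]] := gamma_1fd_tree v tT cT; first by exists v.
have [w vw] : exists w, edge v w.
  have /card_gt1P[x [y [_ _ xy]]] := cT.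
  have [z zv] : exists z, z != v.
    by have [E|] := eqVneq x v; [exists y; rewrite -E eq_sym | exists x].
  case/connectP: (conT v z) => [[|w p]] /=; first by move=> _ E; rewrite E eqxx in zv.
  by case/andP=> vw _ _; exists w.
have [_ /(_ gT)[|[dw _]]] := gamma_1fd_tree w tT cT; first by exists w.
by have := card_le2_pendant_edge conT vw dv dw; rewrite leqNgt c3.
Qed.

(** * From a partial corona to an isomorphism *)

Definition induced_rel (G : sgraph) (C : {set G}) : rel {x | x \in C} :=
  fun x y => edge (val x) (val y).

Lemma induced_rel_sym (G : sgraph) (C : {set G}) : symmetric (@induced_rel G C).
Proof. by move=> x y; exact: edge_sym. Qed.

Lemma induced_rel_irr (G : sgraph) (C : {set G}) : irreflexive (@induced_rel G C).
Proof. by move=> x; exact: edge_irr. Qed.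

Definition induced (G : sgraph) (C : {set G}) : sgraph :=
  SGraph (@induced_rel_sym G C) (@induced_rel_irr G C).

Lemma partial_corona_iso (G : sgraph) (v : G) :
  partial_corona [set: G] v true -> exists H, isomorphic G (corona H).
Proof.
move=> [C [M [EG dCM _ fM fC]]]; exists (induced C).
have fC1 x : x \in C -> #|nbhd x :&: M| == 1 by move=> /fC ->; rewrite orbT.
(* The default [x] is never returned for [x] in [C], which has exactly one neighbor in [M]. *)
pose leaf x := odflt x [pick y in nbhd x :&: M].
have leafP x : x \in C -> nbhd x :&: M = [set leaf x].
  move=> /fC1 /cards1P[y Ey]; rewrite /leaf Ey; case: pickP => [z|/(_ y)].
    by rewrite inE => /eqP ->.
  by rewrite set11.
have leafM x : x \in C -> leaf x \in M.
  by move=> /leafP/setP/(_ (leaf x)); rewrite !inE eqxx => /andP[].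
have leaf_edge x y : x \in C -> y \in M -> edge x y = (y == leaf x).
  by move=> xC yM; have /setP/(_ y) := leafP x xC; rewrite !inE yM andbT.
have MM x y : x \in M -> y \in M -> edge x y = false.
  move=> /fM[_ /eqP]; rewrite cards_eq0 => /eqP/setP/(_ y) + yM.
  by rewrite !inE yM andbT.
have leaf_inj : {in C &, injective leaf}.
  (* A vertex of [M] has a single neighbor in [C], so two centers cannot share a leaf. *)
  move=> x y xC yC E; have [/eqP/cards1P[z /setP Ez] _] := fM _ (leafM _ xC).
  have := Ez x; have := Ez y.
  rewrite !inE ![edge (leaf x) _]edge_sym !leaf_edge ?leafM // xC yC {1}E !eqxx /=.
  by move=> /esym/eqP-> /esym/eqP->.
have CM x : x \in C -> x \in M -> False by move=> xC; rewrite (disjointFr dCM xC).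
pose g (a : corona (induced C)) : G :=
  match a with inl x => val x | inr x => leaf (val x) end.
have g_inj : injective g.
  case=> [x|x] [y|y] /= E.
  - by congr inl; apply: val_inj.
  - by case: (CM _ (valP x)); rewrite /= E; exact: leafM (valP y).
  - by case: (CM _ (valP y)); rewrite /= -E; exact: leafM (valP x).
  - by congr inr; apply/val_inj/leaf_inj; rewrite ?(valP x) ?(valP y).
have g_edge a b : edge (g a) (g b) = edge a b.
  case: a b => [x|x] [y|y] //=.
  - rewrite leaf_edge ?leafM ?(valP x) ?(valP y) // (inj_in_eq leaf_inj) ?(valP x) ?(valP y) //.
    exact: eq_sym.
  - by rewrite edge_sym leaf_edge ?leafM ?(valP x) ?(valP y) //
      (inj_in_eq leaf_inj) ?(valP x) ?(valP y).
  - by rewrite MM ?leafM ?(valP x) ?(valP y).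
have [f fK gK] : bijective g.
  (* The required cardinality bound holds because [g] reaches every vertex, as a center or as the
     leaf of its center. *)
  apply: (inj_card_bij g_inj); apply: leq_trans (leq_image_card g predT).
  apply: subset_leq_card; apply/subsetP=> y _; apply/imageP.
  have: y \in [set: G] by rewrite inE.
  rewrite EG inE => /orP[yC|yM]; first by exists (inl (Sub y yC)).
  have [/eqP/cards1P[x /setP/(_ x)]] := fM _ yM.
  rewrite !inE eqxx => /andP[yx xC] _; exists (inr (Sub x xC)) => //=.
  by apply/eqP; rewrite -leaf_edge // edge_sym.
by exists f => [|x y]; [exists g | rewrite -g_edge !gK].
Qed.

(** * Properties of coronas and the theorem *)

(** The retraction [r] of each leaf onto its center maps edges to edges or single vertices, so walks
    in [T] project to [H]. Cycles of [H] lift to [T] through [inl]. *)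
Lemma isomorphic_corona_tree (T H : sgraph) :
  is_tree T -> isomorphic T (corona H) -> is_tree H.
Proof.
move=> [T0 conT acT] [f [g fK gK] f_edge].
pose r (y : corona H) : H := match y with inl x => x | inr x => x end.
split.
- by have /card_gt0P[v _] := T0; apply/card_gt0P; exists (r (f v)).
- move=> x y; have := conT (g (inl x)) (g (inl y)).
  suff P a b : connect (@edge T) a b -> connect (@edge H) (r (f a)) (r (f b)).
    by move=> /P; rewrite !gK.
  move: b; apply: connect_rooted_ind => [|b c _ Pb]; first exact: connect0.
  rewrite -f_edge; move: Pb; case: (f b) (f c) => [p|p] [q|q] //= Pb.
  + by move=> pq; apply: connect_trans Pb (connect1 pq).
  + by move/eqP <-.
  + by move/eqP <-.
- move=> c c2 /andP[cy uc]; pose h x := g (inl x).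
  have h_inj : injective h by move=> x y /(can_inj gK) [].
  apply: (acT (map h c)); first by rewrite size_map.
  apply/andP; split; last by rewrite map_inj_uniq.
  by apply: homo_cycle cy => x y xy; rewrite -f_edge !gK.
Qed.

Lemma isomorphic_corona_card (G H : sgraph) :
  isomorphic G (corona H) -> #|G| = 2 * #|H|.
Proof.
move=> [f bij_f _]; rewrite (bij_eq_card bij_f) card_sum; lia.
Qed.

(** A dominating set meets each of the disjoint pairs formed by a center and its leaf, since an
    omitted leaf is dominated only by its center; [h] picks one element from each pair. *)
Lemma gamma_1fd_corona (G H : sgraph) :
  isomorphic G (corona H) -> #|H| <= gamma_1fd G.
Proof.
move=> [f [g fK gK] f_edge].
have [D /andP[/forallP domD _] <-] := gamma_1fd_attained G.
pose h (x : H) := if g (inr x) \in D then g (inr x) else g (inl x).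
have fh x y : h x = h y -> x = y.
  rewrite /h; case: ifP => _; case: ifP => _ /(can_inj gK) //; by case.
have hD x : h x \in D.
  rewrite /h; case: ifPn => // /(implyP (domD _)) /existsP[u /andP[uD]].
  rewrite -f_edge gK; case E: (f u) => [y|y] //= /eqP Exy.
  by rewrite Exy -E fK.
rewrite -cardsT -(card_imset _ fh); apply: subset_leq_card.
by apply/subsetP=> _ /imsetP[x _ ->].
Qed.

Theorem theorem3 (T : sgraph) (hT : is_tree T) (hn : (2 <= #|T|)%N) :
  ((gamma_1fd T)%:R <= #|T|%:R / 2 :> rat)%R /\
  (((gamma_1fd T)%:R = #|T|%:R / 2 :> rat)%R <->
   exists H : sgraph, is_tree H /\ isomorphic T (corona H)).
Proof.
have [/card_gt0P[v _] _ _] := hT.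
have [leT _] := gamma_1fd_tree v hT hn.
have half_le (m n : nat) : ((m%:R <= n%:R / 2 :> rat)%R = (2 * m <= n)).
  by rewrite Num.Theory.ler_pdivlMr // -GRing.natrM Num.Theory.ler_nat mulnC.
have half_eq (m n : nat) : (m%:R = n%:R / 2 :> rat)%R <-> 2 * m = n.
  split=> [E|<-]; last by rewrite GRing.natrM GRing.mulrAC GRing.divff ?GRing.mul1r.
  apply/eqP; rewrite -(@Num.Theory.eqr_nat rat) GRing.natrM E.
  by rewrite GRing.mulrC GRing.divfK.
rewrite half_le; split=> //; rewrite half_eq; split.
- move=> /(partial_corona_tree hT hn)[u /partial_corona_iso[H iso]].
  by exists H; split=> //; apply: isomorphic_corona_tree iso.
- move=> [H [_ iso]]; have := gamma_1fd_corona iso.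
  by have := isomorphic_corona_card iso; lia.
Qed.
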